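(* Let $X$ be a compact metrizable space and let $f:X\to X$ be an arbitrary map (no continuity or other regularity is assumed). Then for every $x\in X$ there is $y\in X$ such that $y$ is chain-recurrent (i.e. $y\,\mathcal{C}\,y$) and $x\,\mathcal{C}\,y$.
   Context: A compact dynamical system is a pair $(X,f)$ with $X$ a compact metrizable space and $f:X\to X$ an arbitrary self-map. Fix a metric $d$ compatible with the topology of $X$. For $x,y\in X$ and $\epsilon>0$, an $\epsilon$-chain from $x$ to $y$ is a finite sequence $x_0,x_1,\dots,x_n$ of points of $X$, with $n\ge 1$, such that $x_0=x$, $x_n=y$ and $d(f(x_i),x_{i+1})<\epsilon$ for every $i=0,\dots,n-1$. The chain relation is defined by: $x\,\mathcal{C}\,y$ iff for every $\epsilon>0$ there exists an $\epsilon$-chain from $x$ to $y$. (Since $X$ is compact, $\mathcal{C}$ does not depend on the choice of the compatible metric $d$.) A point $x$ is chain-recurrent if $x\,\mathcal{C}\,x$. *)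

(* Defs.v *)
From mathcomp Require Import all_boot all_order all_algebra.
From mathcomp Require Import all_classical all_reals all_analysis.

Set Implicit Arguments.
Unset Strict Implicit.
Unset Printing Implicit Defensive.

Import Order.TTheory GRing.Theory Num.Theory.

Local Open Scope ring_scope.

(* The finite sequence x_0, x_1, ..., x_n is x :: s with s = [:: x_1; ...; x_n],
   so that n = size s. *)
Definition is_eps_chain (R : realType) (X : metricType R) (f : X -> X)
    (eps : R) (x y : X) (s : seq X) : Prop :=
  [/\ (1 <= size s)%N,
      last x s = y &
      path (fun u v => mdist (f u) v < eps) x s].

Definition chain_rel (R : realType) (X : metricType R) (f : X -> X)
    (x y : X) : Prop :=
  forall eps : R, 0 < eps -> exists s : seq X, is_eps_chain f eps x y s.

Definition chain_recurrent (R : realType) (X : metricType R) (f : X -> X)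
    (x : X) : Prop :=
  chain_rel f x x.

(* Main.v *)
Require Import Defs.
From mathcomp Require Import all_boot all_order all_algebra.
From mathcomp Require Import all_classical all_reals all_analysis.

Local Open Scope classical_set_scope.

(* The chain relation is transitive, relates every [z] to [f z], and has closed
   sections [C(a) = {z | a C z}], whatever [f] is, since only the last point of
   a chain has to be moved. By compactness a family of points linearly
   preordered by C has an upper bound, so Zorn's lemma gives a maximal [y] among
   the points reachable from [x]. As [y C (f y)], maximality gives
   [(f y) C y], hence [y C y]. *)

Section ChainRelation.
Import Order.TTheory GRing.Theory Num.Theory.
Local Open Scope ring_scope.
Context {R : realType} {X : metricType R} (f : X -> X).

Lemma chain_rel_image (x : X) : chain_rel f x (f x).
Proof. by move=> e e0; exists [:: f x]; split=> //=; rewrite mdistxx e0. Qed.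

Lemma chain_rel_trans (x y z : X) :
  chain_rel f x y -> chain_rel f y z -> chain_rel f x z.
Proof.
move=> xy yz e e0.
have [s [s1 sy ps]] := xy e e0; have [t [t1 tz pt]] := yz e e0.
exists (s ++ t); split.
- by rewrite size_cat (leq_trans s1) // leq_addr.
- by rewrite last_cat sy.
- by rewrite cat_path ps sy.
Qed.

Lemma closed_chain_rel (x : X) : closed [set y | chain_rel f x y].
Proof.
move=> y cy e e0.
(* One half of [e] bounds the jumps of a chain to a nearby [z]; the other half pays for replacing
   its endpoint [z] by [y]. *)
have e20 : 0 < e / 2 by rewrite divr_gt0.
have [z [xz yz]] := cy _ (nbhsx_ballx y (e / 2) e20).
have [s [s1 sz ps]] := xz _ e20.
case/lastP: s s1 sz ps => // s w _; rewrite last_rcons => -> {w}.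
rewrite rcons_path => /andP[ps sz].
exists (rcons s y); split; first by rewrite size_rcons.
  by rewrite last_rcons.
rewrite rcons_path; apply/andP; split.
  apply: sub_path ps => u v /= /lt_le_trans; apply.
  by rewrite ler_pdivrMr // ler_peMr ?ler1n // ltW.
apply: le_lt_trans (metric_triangle _ z _) _.
by rewrite [e]splitr ltrD // metric_sym; move: yz; rewrite ballEmdist.
Qed.

(** By transitivity the sections [B i] are nested, so they form a filter base; a cluster point lies
    in each of them, as they are closed. *)
Lemma total_on_chain_rel_ub (I : Type) (A : set I) (p : I -> X) :
  compact [set: X] -> A !=set0 ->
  total_on A (fun i j => p i = p j \/ chain_rel f (p i) (p j)) ->
  exists y, forall i, A i -> chain_rel f (p i) y.
Proof.
move=> X_compact A0 Atot.
pose B i := [set y | chain_rel f (p i) y].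
have FF : ProperFilter (filter_from A B).
  apply: filter_from_proper; last first.
    by move=> i _; exists (f (p i)); exact: chain_rel_image.
  apply: filter_from_filter => // i j Ai Aj.
  case: (Atot _ _ Ai Aj) => -[E|ij].
  - by exists i => // y; rewrite /B /= -E.
  - by exists j => // y jy; split=> //; exact: chain_rel_trans ij jy.
  - by exists i => // y; rewrite /B /= E.
  - by exists i => // y iy; split=> //; exact: chain_rel_trans ij iy.
have [y [_ By]] := X_compact _ FF filterT.
exists y => i Ai; apply: closed_chain_rel => U Uy.
by apply: By Uy; exists i.
Qed.

End ChainRelation.

Theorem theorem3p4 (R : realType) (X : metricType R)
    (X_compact : compact [set: X]) (f : X -> X) (x : X) :
  exists y : X, chain_recurrent f y /\ chain_rel f x y.
Proof.
pose T := {y : X | chain_rel f x y}.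
(* Equality is added because [chain_rel] may fail to be reflexive, while Zorn's lemma is applied to
   a preorder. *)
pose le : rel T :=
  fun u v => `[< sval u = sval v \/ chain_rel f (sval u) (sval v) >].
(* [x] itself may lie outside [T], so [f x] serves as base point and bounds the empty chain. *)
pose fx : T := exist _ _ (chain_rel_image f x).
have [||A Atot|[y xy] ymax] := @ZL_preorder T fx le.
- by move=> u; apply/asboolP; left.
- move=> v u w /asboolP uv /asboolP vw; apply/asboolP.
  case: uv vw => [->//|uv] [<-|vw]; first by right.
  by right; exact: chain_rel_trans uv vw.
- have [[a Aa]|A0] := pselect (A !=set0); last first.
    by exists fx => u Au; case: A0; exists u.
  have [||y Ay] := total_on_chain_rel_ub f T A sval X_compact.
  + by exists a.
  + by move=> u v Au Av; case: (Atot _ _ Au Av) => /asboolP; [left | right].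
  exists (exist _ y (chain_rel_trans f _ _ _ (svalP a) (Ay a Aa))) => u Au.
  by apply/asboolP; right; exact: Ay.
exists y; split=> //.
have yfy := chain_rel_image f y.
have /asboolP := ymax (exist _ _ (chain_rel_trans f _ _ _ xy yfy))
                      (asboolT (or_intror yfy)).
(* In the equality case [y] is a fixed point, and [yfy] already relates [y] to itself. *)
case=> /= [fyy|fyy]; last exact: chain_rel_trans yfy fyy.
by rewrite /chain_recurrent -{2}fyy.
Qed.
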